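(* Let $t$ be a positive integer, let $R=\bigoplus_{\underline{n}\in\mathbb{N}^t}R_{\underline{n}}$ be a commutative Noetherian $\mathbb{N}^t$-graded ring with unity, and let $L=\bigoplus_{\underline{n}\in\mathbb{N}^t}L_{\underline{n}}$ be a finitely generated $\mathbb{N}^t$-graded $R$-module. Set $A=R_{(0,\ldots,0)}$. Then there exists a positive integer $k$ such that for each $\underline{n}\in\mathbb{N}^t$ with $L_{\underline{n}}\neq 0$, there exists an (irredundant and minimal) primary decomposition of the zero submodule $O_{\underline{n}}$ of the $A$-module $L_{\underline{n}}$, $$O_{\underline{n}}=Q_{\underline{n},1}\cap Q_{\underline{n},2}\cap\cdots\cap Q_{\underline{n},r_{\underline{n}}},$$ where $Q_{\underline{n},i}$ is a $P_{\underline{n},i}$-primary component of $O_{\underline{n}}$ in $L_{\underline{n}}$, satisfying $$P_{\underline{n},i}^k L_{\underline{n}}\subseteq Q_{\underline{n},i}\quad\text{for all } i=1,2,\ldots,r_{\underline{n}}.$$ (The integer $k$ is independent of $\underline{n}$ and $i$.)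
   Context: $\mathbb{N}$ denotes the set of non-negative integers. Each $L_{\underline{n}}$ is regarded as a (finitely generated) module over the Noetherian ring $A=R_{(0,\ldots,0)}$, and $O_{\underline{n}}$ denotes the zero submodule of $L_{\underline{n}}$. For finitely generated modules $N\subsetneq M$ over a commutative Noetherian ring $A$, a submodule $Q$ of $M$ is called $P$-primary if $\mathrm{Ass}_A(M/Q)=\{P\}$. A primary decomposition of $N$ in $M$ always means an irredundant and minimal one: an expression $N=Q_1\cap\cdots\cap Q_r$ in which each $Q_i$ is a $P_i$-primary submodule of $M$, the primes $P_1,\ldots,P_r$ are pairwise distinct, and no $Q_i$ can be omitted from the intersection; in this case $\mathrm{Ass}_A(M/N)=\{P_1,\ldots,P_r\}$, and $Q_i$ is called a $P_i$-primary component of $N$ in $M$. *)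

(* Defs.v *)
From HB Require Import structures.
From mathcomp Require Import all_boot all_algebra.
From mathcomp Require Import boolp classical_sets.

Set Implicit Arguments.
Unset Strict Implicit.
Unset Printing Implicit Defensive.

Import GRing.Theory.
Local Open Scope classical_set_scope.
Local Open Scope ring_scope.

Section Modules.
Variables (A : comPzRingType) (M : lmodType A).
Implicit Types (P I : set A) (N Q : set M).

Definition submodule N : Prop := GRing.submod_closed [in N].

Definition fg_submodule N : Prop :=
  exists s : seq M, N = smallest submodule [set` s].

Definition idealM I N : set M :=
  smallest submodule [set a *: x | a in I & x in N].

End Modules.

Section Ideals.
Variable A : comPzRingType.

(* Ideals are the submodules of the regular module A^o. *)
Definition ideal (I : set A) : Prop := @submodule A A^o I.

Definition prime_ideal (P : set A) : Prop :=
  [/\ ideal P, ~ P 1 & forall a b, P (a * b) -> P a \/ P b].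

Definition noetherian : Prop :=
  forall I : set A, ideal I -> @fg_submodule A A^o I.

Definition idealX (I : set A) (k : nat) : set A :=
  iter k (@idealM A A^o I) setT.

End Ideals.

Section PrimaryDecomposition.
Variables (A : comPzRingType) (M : lmodType A).
Implicit Types (P : set A) (N Q : set M).

(* The set Ass_A(M / N): since no quotient module is formed, the annihilator
   of the class of x in M / N is written [set a | a *: x \in N]. *)
Definition Ass N : set (set A) :=
  [set P | prime_ideal P /\ exists x : M, P = [set a | N (a *: x)]].

Definition primary P Q : Prop := submodule Q /\ Ass Q = [set P].

Definition primary_decomposition N (r : nat)
    (P : 'I_r -> set A) (Q : 'I_r -> set M) : Prop :=
  [/\ forall i, primary (P i) (Q i),
      injective P,
      N = \bigcap_(i in setT) Q i
    & forall j, N <> \bigcap_(i in [set~ j]) Q i].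

End PrimaryDecomposition.

Notation degree t := {ffun 'I_t -> nat}.

Section Gradings.
Variable t : nat.

(* V is the internal direct sum of the subgroups C n. The predicates C n are
   boolean, which is no restriction: membership in C n amounts to being equal
   to one's own component of degree n. *)
Definition direct_sum (V : zmodType) (C : degree t -> {pred V}) : Prop :=
  [/\ forall n, GRing.zmod_closed (C n),
      forall x, exists (s : seq (degree t)) (f : degree t -> V),
        [/\ uniq s, forall n, f n \in C n & x = \sum_(n <- s) f n]
    & forall (s : seq (degree t)) (f : degree t -> V),
        uniq s -> (forall n, f n \in C n) -> \sum_(n <- s) f n = 0 ->
        forall n, n \in s -> f n = 0].

Record ring_grading (R : comPzRingType) := RingGrading {
  rcomp :> degree t -> {pred R};
  rcomp_sum : direct_sum rcomp;
  rcompM : forall m n a b,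
    a \in rcomp m -> b \in rcomp n -> a * b \in rcomp (m + n)
}.

Record module_grading (R : comPzRingType) (gR : ring_grading R)
    (L : lmodType R) := ModuleGrading {
  mcomp :> degree t -> {pred L};
  mcomp_sum : direct_sum mcomp;
  mcompZ : forall m n a x,
    a \in gR m -> x \in mcomp n -> a *: x \in mcomp (m + n)
}.

End Gradings.

Section DegreeZero.
Variables (t : nat) (R : comPzRingType) (gR : ring_grading t R).

Lemma rcomp0_1 : 1 \in gR 0.
Proof.
have [Cz Cd Ci] := rcomp_sum gR.
have C0 n : 0 \in gR n by case: (Cz n).
have [s [e [s_uniq eC def1]]] := Cd 1.
pose f n := if n \in s then e n else 0.
have fC n : f n \in gR n by rewrite /f; case: ifP.
pose s' := 0 :: rem 0 s.
have s'_uniq : uniq s' by rewrite /= mem_rem_uniq // inE eqxx rem_uniq.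
have def1' : 1 = \sum_(n <- s') f n.
  rewrite big_cons def1 (eq_big_seq f) => [|n ns]; last by rewrite /f ns.
  have [s0|s0] := boolP (0 \in s); first by rewrite (big_rem _ s0).
  by rewrite rem_id // {2}/f (negPf s0) add0r.
have addI m : injective (fun n : degree t => m + n).
  move=> n1 n2 /ffunP E; apply/ffunP => i.
  by move: (E i); rewrite !ffunE => /addnI.
have homog m x : x \in gR m -> x * f 0 = x.
  move=> xm; pose g k := if k == m then x - x * f 0 else
    if [pick n : seq_sub s' | m + val n == k] is Some n
    then - (x * f (val n)) else 0.
  have opp n y : y \in gR n -> - y \in gR n.
    by move=> yn; have [_ /(_ 0 y (C0 n) yn)] := Cz n; rewrite sub0r.
  have gC k : g k \in gR k.
    rewrite /g; case: eqP => [->|_].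
      have [_ B] := Cz m; apply: B => //.
      by rewrite -[X in gR X]addr0; apply: rcompM.
    case: pickP => [n /eqP <-|_]; last exact: C0.
    by apply: opp; apply: rcompM.
  have gE n : n \in s' -> g (m + n) = (if n == 0 then x else 0) - x * f n.
    move=> ns; rewrite /g -[X in _ == X]addr0 (inj_eq (@addI m)).
    have [->//|n0] := eqVneq n 0; rewrite sub0r.
    case: pickP => [n' /eqP/addI->//|/(_ (SeqSub ns))].
    by rewrite /= eqxx.
  have gs : \sum_(k <- [seq m + n | n <- s']) g k = 0.
    rewrite big_map (eq_big_seq _ gE) big_split /= sumrN -mulr_sumr -def1'.
    rewrite mulr1 big_cons eqxx big_seq big1 ?addr0 ?subrr // => n.
    by rewrite mem_rem_uniq // inE => /andP[/negPf->].
  have := Ci _ g _ gC gs m; rewrite map_inj_uniq // => /(_ s'_uniq).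
  have -> : m \in [seq m + n | n <- s'] by rewrite /= addr0 inE eqxx.
  by move=> /(_ isT); rewrite /g eqxx => /eqP; rewrite subr_eq0 => /eqP.
suff <- : f 0 = 1 by [].
rewrite -[LHS]mul1r [in LHS]def1 mulr_suml [RHS]def1.
by apply: eq_bigr => n _; apply: homog (eC n).
Qed.

Lemma rcomp0_subring : GRing.subring_closed (gR 0).
Proof.
have [Cz _ _] := rcomp_sum gR.
split; [exact: rcomp0_1 | by case: (Cz 0) |].
by move=> a b a0 b0; rewrite -[0]addr0; apply: rcompM.
Qed.

HB.instance Definition _ :=
  GRing.isSubringClosed.Build R (rcomp gR 0) rcomp0_subring.

Definition degree0 : Type := {a : R | a \in gR 0}.
HB.instance Definition _ := SubChoice.on degree0.
HB.instance Definition _ :=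
  GRing.SubChoice_isSubComPzRing.Build R _ degree0 rcomp0_subring.

End DegreeZero.

Section Component.
Variables (t : nat) (R : comPzRingType) (gR : ring_grading t R).
Variables (L : lmodType R) (gL : module_grading gR L) (n : degree t).

Lemma mcomp_zmod : GRing.zmod_closed (gL n).
Proof. by case: (mcomp_sum gL). Qed.

HB.instance Definition _ := GRing.isZmodClosed.Build L (mcomp gL n) mcomp_zmod.

Definition component : Type := {x : L | x \in gL n}.
HB.instance Definition _ := SubChoice.on component.
HB.instance Definition _ := [SubChoice_isSubZmodule of component by <:].

Lemma component_scale_subproof (a : degree0 gR) (x : component) :
  val a *: val x \in gL n.
Proof. by have := mcompZ (valP a) (valP x); rewrite add0r. Qed.

Definition component_scale (a : degree0 gR) (x : component) : component :=
  Sub (val a *: val x) (component_scale_subproof a x).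

Fact component_scaleA a b x :
  component_scale a (component_scale b x) = component_scale (a * b) x.
Proof. by apply: val_inj; rewrite !SubK scalerA. Qed.

Fact component_scale1 : left_id 1 component_scale.
Proof. by move=> x; apply: val_inj; rewrite SubK rmorph1 scale1r. Qed.

Fact component_scaleDr : right_distributive component_scale +%R.
Proof. by move=> a x y; apply: val_inj; rewrite !SubK scalerDr. Qed.

Fact component_scaleDl x : {morph component_scale^~ x : a b / a + b}.
Proof. by move=> a b; apply: val_inj; rewrite !SubK scalerDl. Qed.

HB.instance Definition _ :=
  GRing.Zmodule_isLmodule.Build (degree0 gR) component
    component_scaleA component_scale1 component_scaleDr component_scaleDl.

End Component.

(* Main.v *)
Require Import Defs.
From mathcomp Require Import all_boot all_algebra.
From mathcomp Require Import boolp classical_sets.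

(** No graded primary decomposition is needed.  Decompose the zero submodule of
    [L] over [R] as an intersection of [Q] with associated primes [P] and
    [P^k L] contained in [Q], with a common [k].  Restricting to [A] and [L_n],
    the pairs [(P, Q)] become pairs [(P :&: A, Q :&: L_n)] with the same two
    properties: [a x] in [Q] implies [a] in [P] or [x] in [Q], and [P^k] sends
    everything into [Q].  These properties alone make [Q] equal to the whole
    module or [P]-primary, and they are stable under intersection for a fixed
    [P]; hence a shortest such family is an irredundant minimal primary
    decomposition, and it keeps the exponent [k]. *)

Set Implicit Arguments.
Unset Strict Implicit.

Import GRing.Theory.
Local Open Scope classical_set_scope.
Local Open Scope ring_scope.

(** * Closure properties of submodules *)

Section Submodules.
Variables (A : comPzRingType) (M : lmodType A).
Implicit Types (N Q : set M).

Lemma submoduleP N : submodule N <->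
  N 0 /\ (forall a x y, N x -> N y -> N (a *: x + y)).
Proof.
split=> [[N0 NL]|[N0 NL]]; split.
- by move: N0; rewrite !inE.
- by move=> a x y Nx Ny; have := NL a x y; rewrite !inE; apply.
- by rewrite inE.
- by move=> a x y; rewrite !inE; apply: NL.
Qed.

Lemma submodule0 N : submodule N -> N 0.
Proof. by move=> /submoduleP[]. Qed.

Lemma submoduleD N x y : submodule N -> N x -> N y -> N (x + y).
Proof.
by move=> /submoduleP[_ NL] Nx Ny; rewrite -[x]scale1r; apply: NL.
Qed.

Lemma submoduleZ N a x : submodule N -> N x -> N (a *: x).
Proof.
by move=> /submoduleP[N0 NL] Nx; rewrite -[_ *: _]addr0; apply: NL.
Qed.

Lemma submoduleB N x y : submodule N -> N x -> N y -> N (x - y).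
Proof.
move=> sN Nx Ny; rewrite -scaleN1r.
by apply: submoduleD => //; apply: submoduleZ.
Qed.

Lemma submoduleI N Q : submodule N -> submodule Q -> submodule (N `&` Q).
Proof.
move=> /submoduleP[N0 NL] /submoduleP[Q0 QL]; apply/submoduleP.
by split=> // a x y [Nx Qx] [Ny Qy]; split; [apply: NL|apply: QL].
Qed.

Lemma submodule_bigcap (I : Type) (D : set I) (N : I -> set M) :
  (forall i, D i -> submodule (N i)) -> submodule (\bigcap_(i in D) N i).
Proof.
move=> sN; apply/submoduleP; split=> [i Di|a x y Nx Ny i Di].
  exact: submodule0 (sN i Di).
apply: submoduleD (sN i Di) _ (Ny i Di).
exact: submoduleZ (sN i Di) (Nx i Di).
Qed.

Lemma smallest_submodule (G : set M) : submodule (smallest (@submodule A M) G).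
Proof. by apply: submodule_bigcap => N []. Qed.

Lemma submodule_colon N a : submodule N -> submodule [set x | N (a *: x)].
Proof.
move=> sN; apply/submoduleP; split=> /= [|b x y Nx Ny].
  by rewrite scaler0; apply: submodule0.
rewrite scalerDr scalerA mulrC -scalerA.
by apply: submoduleD => //; apply: submoduleZ.
Qed.

End Submodules.

Lemma idealP (A : comPzRingType) (I : set A) : ideal I <->
  I 0 /\ (forall a b c, I b -> I c -> I (a * b + c)).
Proof. exact: (@submoduleP A A^o). Qed.

(** * Noetherian modules *)

Section NoetherianModules.
Variables (A : comPzRingType) (M : lmodType A).
Implicit Types (N Q : set M).

Lemma ideal_annihilator N x : submodule N -> ideal [set a | N (a *: x)].
Proof.
move=> sN; apply/idealP; split=> /= [|b a c Na Nc].
  by rewrite scale0r; apply: submodule0.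
by rewrite scalerDl -scalerA; apply: submoduleD => //; apply: submoduleZ.
Qed.

(** The set is [N + a M]. *)
Lemma submodule_addZ N a : submodule N ->
  submodule [set x | exists2 y, N y & exists w, x = y + a *: w].
Proof.
move=> sN; apply/submoduleP; split=> [|b _ _ [y Ny [w ->]] [z Nz [v ->]]].
  by exists 0; [exact: submodule0|exists 0; rewrite scaler0 addr0].
exists (b *: y + z); first by apply: submoduleD => //; apply: submoduleZ.
by exists (b *: w + v); rewrite !scalerDr !scalerA [a * b]mulrC addrACA.
Qed.

Definition noetherian_module := forall N, submodule N -> fg_submodule N.

(** The union of the chain is a submodule, and its finitely many generators already lie in a single
    [N m]. *)
Lemma chain_stabilizes (N : nat -> set M) : noetherian_module ->
  (forall m, submodule (N m)) -> (forall m, N m `<=` N m.+1) ->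
  exists m, forall p, N p `<=` N m.
Proof.
move=> noethM sN incN.
have monoN m p : (m <= p)%N -> N m `<=` N p.
  move=> /subnK <-; elim: (p - m)%N => [//|d IHd].
  exact: subset_trans IHd (incN _).
pose U := [set x | exists m, N m x].
have [|s Us] := noethM U.
  apply/submoduleP; split=> [|a x y [m Nx] [p Ny]].
    by exists 0%N; apply: submodule0.
  exists (maxn m p); apply: submoduleD => //.
    by apply: submoduleZ => //; apply: monoN Nx; apply: leq_maxl.
  by apply: monoN Ny; apply: leq_maxr.
have sU : {subset s <= [in U]}.
  by move=> x xs; rewrite inE Us; apply: sub_gen_smallest.
have [m sNm] : exists m, forall x, x \in s -> N m x.
  elim: s sU {Us} => [|x s IHs] sU; first by exists 0%N.
  have [y ys|m sNm] := IHs; first by apply: sU; rewrite inE ys orbT.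
  have := sU x (mem_head _ _); rewrite inE => -[p Npx].
  exists (maxn m p) => y; rewrite inE => /orP[/eqP->|ys].
    by apply: monoN Npx; apply: leq_maxr.
  by apply: monoN (sNm y ys); apply: leq_maxl.
exists m => p x Nx; have : U x by exists p.
by rewrite Us; apply; split.
Qed.

(** Every counterexample has a strictly larger one, so choice would build a chain that never
    stabilizes. *)
Lemma noetherian_ind (D : set M -> Prop) : noetherian_module ->
  (forall N, submodule N ->
     (forall N', submodule N' -> N `<=` N' -> ~ N' `<=` N -> D N') -> D N) ->
  forall N, submodule N -> D N.
Proof.
move=> noethM indD N sN; apply: contrapT => nDN.
pose bad := {N : set M | submodule N /\ ~ D N}.
have next (B : bad) :
    {B' : bad | projT1 B `<=` projT1 B' /\ ~ projT1 B' `<=` projT1 B}.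
  apply: cid; case: B => [B [sB nDB]] /=; apply: contrapT => noB.
  apply: nDB; apply: indD => // B' sB' BB' nB'B.
  by apply: contrapT => nDB'; apply: noB; exists (exist _ B' (conj sB' nDB')).
pose c := fix c m : bad :=
  if m is m'.+1 then projT1 (next (c m')) else exist _ N (conj sN nDN).
have [m cm] : exists m, forall p, projT1 (c p) `<=` projT1 (c m).
  apply: chain_stabilizes => [//|m|m]; first by case: (projT2 (c m)).
  by case: (projT2 (next (c m))).
by case: (projT2 (next (c m))) => _; apply; apply: (cm m.+1).
Qed.

End NoetherianModules.

(** Induction on the generators: a submodule of the span of [x :: s] is controlled by its part
    inside the span of [s] and by the ideal of coefficients of [x] in its elements. *)
Lemma fg_noetherian_module (R : comPzRingType) (L : lmodType R) :
  noetherian R -> fg_submodule [set: L] -> noetherian_module L.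
Proof.
move=> noethR [s Ls].
pose span (s : seq L) := smallest (@submodule R L) [set` s].
suff fg_sub N : submodule N -> N `<=` span s -> fg_submodule N.
  by move=> N sN; apply: fg_sub; rewrite // /span -Ls.
elim: s N {Ls} => [|x s IHs] N sN Ns.
  exists [::]; apply/seteqP; split=> // y; apply; split=> //.
have sspan u : submodule (span u) by apply: smallest_submodule.
have spanL u a y z : span u y -> span u z -> span u (a *: y + z).
  by have /submoduleP[_] := sspan u; apply.
have span_cons : span (x :: s) `<=`
    [set y | exists a, exists2 z, span s z & y = a *: x + z].
  apply: smallest_sub.
    apply/submoduleP; split=> [|b _ _ [a [z sz ->]] [c [w sw ->]]].
      by exists 0, 0; rewrite ?scale0r ?addr0 //; apply: submodule0.
    exists (b * a + c), (b *: z + w).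
      exact: spanL.
    by rewrite scalerDr scalerDl scalerA addrACA.
  move=> y /=; rewrite inE => /orP[/eqP->|ys].
    by exists 1, 0; rewrite ?scale1r ?addr0 //; apply: submodule0.
  by exists 0, y; [exact: sub_gen_smallest|rewrite scale0r add0r].
have [u Nu] : fg_submodule (N `&` span s).
  by apply: IHs; [exact: submoduleI|move=> y []].
pose I : set R := [set a | exists2 z, span s z & N (a *: x + z)].
have [|v Iv] := noethR I.
  apply/idealP; split=> [|b a c [z sz Nz] [w sw Nw]].
    by exists 0; rewrite ?scale0r ?addr0; apply: submodule0.
  exists (b *: z + w); first exact: spanL.
  rewrite scalerDl -scalerA addrACA -scalerDr.
  by apply: submoduleD => //; apply: submoduleZ.
(* [v'] lifts each generator [a] of [I] to an element [a *: x + z] of [N]. *)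
have [v' [v'N Iv']] : exists v' : seq L, (forall y, y \in v' -> N y) /\
    forall a, a \in v -> exists2 z, span s z & a *: x + z \in v'.
  have : {subset v <= [in I]}.
    by move=> a av; rewrite inE Iv; apply: sub_gen_smallest.
  elim: v {Iv} => [|a v IHv] vI; first by exists [::].
  have [b bv|v' [v'N Iv']] := IHv; first by apply: vI; rewrite inE bv orbT.
  have := vI a (mem_head _ _); rewrite inE => -[z sz Nz].
  exists (a *: x + z :: v'); split=> [y|b].
    by rewrite inE => /orP[/eqP->|/v'N].
  rewrite inE => /orP[/eqP->|/Iv'[w sw wv']].
    by exists z; rewrite ?mem_head.
  by exists w; rewrite // inE wv' orbT.
exists (u ++ v'); apply/seteqP; split=> [y Ny|y]; last first.
  apply; split=> // z /=; rewrite mem_cat => /orP[zu|/v'N//].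
  suff: (N `&` span s) z by case.
  by rewrite Nu; apply: sub_gen_smallest.
have uS z : (N `&` span s) z -> span (u ++ v') z.
  rewrite Nu; apply; split=> // w /= wu; apply: sub_gen_smallest => /=.
  by rewrite mem_cat wu.
have v'S z : z \in v' -> span (u ++ v') z.
  by move=> zv'; apply: sub_gen_smallest; rewrite /= mem_cat zv' orbT.
have [a [z sz def_y]] := span_cons y (Ns y Ny).
(* The lifts generate an element of [N] with the same coefficient [a] as [y]; subtracting it from
   [y] leaves an element of [N] in [span s], which [u] generates. *)
have [w sw [Nw Sw]] : exists2 w, span s w &
    N (a *: x + w) /\ span (u ++ v') (a *: x + w).
  have : I a by exists z; rewrite // -def_y.
  rewrite {1}Iv; move: a {def_y}; apply: smallest_sub.
    apply/idealP; split=> [|b c d [w sw [Nw Sw]] [w' sw' [Nw' Sw']]].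
      by exists 0; rewrite ?scale0r ?addr0; do ?split; apply: submodule0.
    exists (b *: w + w'); first exact: spanL.
    rewrite scalerDl -scalerA addrACA -scalerDr.
    by split; [apply: submoduleD => //; apply: submoduleZ|exact: spanL].
  by move=> b /= /Iv'[w sw wv']; exists w; do ?split; auto.
rewrite -[y](subrK (a *: x + w)); apply: (submoduleD (sspan _)) Sw.
apply: uS; split; first exact: submoduleB.
by rewrite def_y opprD addrACA subrr add0r; apply: (submoduleB (sspan s)).
Qed.

(** * Primary submodules with a prescribed exponent *)

Section PowerPrimary.
Variables (A : comPzRingType) (M : lmodType A).
Implicit Types (P : set A) (N Q : set M).

(* [P] is not required to be a prime ideal, nor even an ideal: this follows as
   soon as [Q] is proper.  The case [Q = setT] is allowed. *)
Definition power_primary k P Q : Prop :=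
  [/\ submodule Q,
      forall a x, Q (a *: x) -> P a \/ Q x
    & forall l : seq A, {subset l <= [in P]} -> (k <= size l)%N ->
        forall x, Q ((\prod_(a <- l) a) *: x)].

Lemma power_primary_leq k k' P Q :
  (k <= k')%N -> power_primary k P Q -> power_primary k' P Q.
Proof.
move=> kk' [sQ PQ kQ]; split=> // l lP kl.
by apply: kQ => //; apply: leq_trans kl.
Qed.

Lemma power_primaryI k P Q Q' : power_primary k P Q -> power_primary k P Q' ->
  power_primary k P (Q `&` Q').
Proof.
move=> [sQ PQ kQ] [sQ' PQ' kQ']; split; first exact: submoduleI.
  by move=> a x [/PQ[]Qa /PQ'[]Q'a]; [left|left|left|right].
by move=> l lP kl x; split; [apply: kQ|apply: kQ'].
Qed.

Lemma power_primary_annihilator k P Q x : power_primary k P Q -> ~ Q x ->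
  exists2 y, ~ Q y & P = [set a | Q (a *: y)].
Proof.
move=> [sQ PQ kQ] nQx.
(* A product of elements of [P] of maximal length that does not send [x]
   into [Q] sends it to the required [y]. *)
suff [y nQy Py] : exists2 y, ~ Q y & forall a, P a -> Q (a *: y).
  exists y => //; apply/seteqP; split=> // a /PQ[]//.
have: forall l, {subset l <= [in P]} -> (k <= size l)%N ->
        Q ((\prod_(a <- l) a) *: x) by move=> l lP kl; apply: kQ.
elim: k {kQ} x nQx => [|k IHk] x nQx kQ.
  by case: nQx; rewrite -[x]scale1r; have := kQ [::]; rewrite big_nil; apply.
have [[a Pa nQax]|noa] := pselect (exists2 a, P a & ~ Q (a *: x)).
  apply: IHk nQax _ => l lP kl; rewrite scalerA mulrC.
  have := kQ (a :: l); rewrite big_cons; apply=> // b.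
  rewrite inE => /orP[/eqP->|/lP//].
  by rewrite inE.
by exists x => // a Pa; apply: contrapT => nQax; apply: noa; exists a.
Qed.

(** [P] is the annihilator of a class modulo [Q], and the second condition makes it prime. For any
    associated prime [P'], that condition puts [P'] inside [P], while the exponent puts [a ^+ k],
    hence [a], in [P'] for every [a] in [P]. *)
Lemma power_primary_primary k P Q :
  power_primary k P Q -> Q <> setT -> primary P Q.
Proof.
move=> ppQ nQT; have [sQ PQ kQ] := ppQ.
have [x nQx] : exists x, ~ Q x.
  apply: contrapT => noQ; apply: nQT; apply/seteqP; split=> // x _.
  by apply: contrapT => nQx; apply: noQ; exists x.
have [y nQy Py] := power_primary_annihilator ppQ nQx.
split=> //; apply/seteqP; split=> [P' [[iP' P'1 P'M] [z P'z]]|_ ->]; last first.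
  split; last by exists y.
  split.
  - by rewrite /ideal Py; apply: ideal_annihilator.
  - by rewrite Py /= scale1r.
  - move=> a b; rewrite [in X in X -> _]Py /= -scalerA => /PQ[]; first by left.
    by move=> Qby; right; rewrite Py.
apply/seteqP; split=> a.
  rewrite P'z => /PQ[]// Qz; case: P'1; rewrite P'z /=.
  exact: submoduleZ.
move=> Pa; have : P' (a ^+ k).
  rewrite P'z /=; have := kQ (nseq k a) _ _ z.
  rewrite big_nseq iter_mulr_1 size_nseq; apply=> // b.
  by rewrite mem_nseq => /andP[_ /eqP->]; rewrite inE.
elim: k {ppQ kQ} => [//|k IHk]; rewrite exprS.
by move=> /P'M[].
Qed.

(** Passes from products of elements to iterated ideal powers: induction on [k] peels off one factor
    [b] and replaces [Q] by the colon [(Q : b)]. *)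
Lemma power_primary_idealM k P Q :
  power_primary k P Q -> idealM (idealX P k) setT `<=` Q.
Proof.
move=> [sQ _ kQ]; apply: smallest_sub => // _ [a Pka [x _ <-]].
(* Products of exactly [k] factors are kept: this weaker property passes to [(Q : b)] with [k]
   lowered by one. *)
have {}kQ l y : {subset l <= [in P]} -> size l = k ->
    Q ((\prod_(b <- l) b) *: y).
  by move=> lP kl; apply: kQ; rewrite ?kl.
elim: k Q a sQ kQ Pka x => [|k IHk] Q a sQ kQ Pka x.
  apply: submoduleZ => //; rewrite -[x]scale1r.
  by have := kQ [::] x; rewrite big_nil; apply.
suff: idealX P k.+1 `<=` [set a | forall x, Q (a *: x)] by apply.
apply: smallest_sub.
  apply/idealP; split=> [y|b c d Qc Qd y].
    by rewrite scale0r; apply: submodule0.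
  by rewrite scalerDl -scalerA; apply: submoduleD => //; apply: submoduleZ.
move=> _ [b Pb [c Pkc <-]] y /=; rewrite -scalerA.
apply: (IHk [set z | Q (b *: z)]) => //; first exact: submodule_colon.
move=> l z lP kl /=; rewrite scalerA.
have := kQ (b :: l) z; rewrite big_cons /= kl; apply=> // d.
by rewrite inE => /orP[/eqP->|/lP//]; rewrite inE.
Qed.

Lemma power_primary_setT k P : power_primary k P setT.
Proof. by split=> //; [apply/submoduleP|right]. Qed.

(** Strong induction on the length: a redundant component is dropped, or two components with the
    same [P] are merged into their intersection, always with the same [k]. *)
Lemma minimal_power_primary_decomposition k r N
    (P : 'I_r -> set A) (Q : 'I_r -> set M) :
  (forall i, power_primary k (P i) (Q i)) -> N = \bigcap_(i in setT) Q i ->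
  exists (r' : nat) (P' : 'I_r' -> set A) (Q' : 'I_r' -> set M),
    primary_decomposition N P' Q' /\
    forall i, power_primary k (P' i) (Q' i).
Proof.
elim/ltn_ind: r => r IHr in P Q * => ppQ defN.
have [] := pselect (primary_decomposition N P Q); first by exists r, P, Q.
move=> ndPQ; case: r => [|r] in IHr P Q ppQ defN ndPQ *.
  by case: ndPQ; split=> // -[].
have [[j Nj]|irr] := pselect (exists j, N = \bigcap_(i in [set~ j]) Q i).
  apply: (IHr r _ (P \o lift j) (Q \o lift j)) => // [i|]; first exact: ppQ.
  rewrite Nj; apply/seteqP; split=> x Qx i /= ij.
    by apply: Qx; apply/eqP; rewrite eq_sym neq_lift.
  by case: (unliftP j i) ij => [i' ->|->] // _; apply: Qx.
have [i [j [ij Pij]]] : exists i j, i <> j /\ P i = P j.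
  apply: contrapT => injP; apply: ndPQ; split=> //.
  (* A component equal to the whole module could be omitted, so irredundancy forces properness. *)
  - move=> i; apply: power_primary_primary (ppQ i) _ => QiT.
    apply: irr; exists i; rewrite defN; apply/seteqP; split=> x Qx j /=.
      by move=> _; apply: Qx.
    by have [->|/eqP ji] := eqVneq j i; [rewrite QiT|move=> _; apply: Qx].
  - by move=> i j Pij; apply: contrapT => ij; apply: injP; exists i, j.
  - by move=> j Nj; apply: irr; exists j.
have [j' def_j] : exists j', j = lift i j'.
  by case: (unliftP i j) ij => [j' ->|->] // _; exists j'.
(* Index [i] disappears and [Q i] is absorbed into the component at [j]. *)
pose Q' l := if l == j' then Q i `&` Q j else Q (lift i l).
apply: (IHr r _ (P \o lift i) Q') => // [l|].
  rewrite /Q' /=; case: eqP => [->|_]; last exact: ppQ.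
  by rewrite -def_j; apply: power_primaryI; rewrite // -Pij.
rewrite defN; apply/seteqP; split=> x Qx l _.
  by rewrite /Q'; case: eqP => _; [split|]; apply: Qx.
have [Qix Qjx] : (Q i `&` Q j) x by have := Qx j' I; rewrite /Q' eqxx.
case: (unliftP i l) => [l' ->|->] //.
by have := Qx l' I; rewrite /Q'; case: eqP => // -> _; rewrite -def_j.
Qed.

End PowerPrimary.

(** To be applied with [g] and [f] the inclusions [val] of [degree0] and of a graded component. *)
Lemma power_primary_preimage (A R : comPzRingType) (M : lmodType A)
    (L : lmodType R) (g : {rmorphism A -> R}) (f : {additive M -> L})
    k (P : set R) (Q : set L) :
  (forall a x, f (a *: x) = g a *: f x) -> power_primary k P Q ->
  power_primary k (g @^-1` P) (f @^-1` Q).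
Proof.
move=> fZ [sQ PQ kQ]; split=> [|a x|l lP kl x].
- apply/submoduleP; split=> [|a x y Qx Qy] /=.
    by rewrite raddf0; apply: submodule0.
  by rewrite raddfD fZ; apply: submoduleD => //; apply: submoduleZ.
- by rewrite /= fZ => /PQ.
- rewrite /= fZ rmorph_prod -(big_map g predT id); apply: kQ.
    by move=> _ /mapP[a /lP Pa ->]; move: Pa; rewrite !inE.
  by rewrite size_map.
Qed.

(** * Existence of decompositions over a Noetherian ring *)

Section NoetherianPowerPrimary.
Variables (R : comPzRingType) (L : lmodType R).
Hypotheses (noethR : noetherian R) (noethL : noetherian_module L).
Implicit Types (N Q : set L).

(** In this form the whole module also counts as irreducible. *)
Definition irreducible_submodule Q := forall N1 N2,
  submodule N1 -> submodule N2 -> Q `<=` N1 -> Q `<=` N2 ->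
  N1 `&` N2 `<=` Q -> N1 `<=` Q \/ N2 `<=` Q.

(** For proper [Q], [P] is the set of zero divisors modulo [Q]. Irreducibility makes it an ideal
    whose elements act nilpotently modulo [Q]; its finite generation and the chain condition then
    give a uniform exponent. *)
Lemma irreducible_power_primary Q : submodule Q -> irreducible_submodule Q ->
  exists k P, power_primary k P Q.
Proof.
move=> sQ irrQ.
have [[x0 nQx0]|QT] := pselect (exists x, ~ Q x); last first.
  exists 0%N, setT; suff -> : Q = setT by apply: power_primary_setT.
  apply/seteqP; split=> // x _; apply: contrapT => nQx; apply: QT.
  by exists x.
pose P : set R := [set a | exists2 x, ~ Q x & Q (a *: x)].
have colonQ a : Q `<=` [set x | Q (a *: x)] by move=> x; apply: submoduleZ.
have idP : ideal P.
  apply/idealP; split=> [|a b c [x nQx Qbx] [y nQy Qcy]].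
    by exists x0; rewrite ?scale0r //; apply: submodule0.
  (* If [a * b + c] is outside [P], the colons [(Q : b)] and [(Q : c)] meet inside [Q], so one of
     them lies in [Q], against the choice of [x] and [y]. *)
  apply: contrapT => nP.
  have [] := irrQ _ _ (submodule_colon b sQ) (submodule_colon c sQ)
                  (colonQ b) (colonQ c).
  - move=> z [/= Qbz Qcz]; apply: contrapT => nQz; apply: nP; exists z => //.
    by rewrite scalerDl -scalerA; apply: submoduleD => //; apply: submoduleZ.
  - by move=> /(_ x Qbx).
  - by move=> /(_ y Qcy).
have nilP a : P a -> exists m, forall x, Q (a ^+ m *: x).
  (* Once [(Q : a^m)] is stable, [(Q : a)] and [Q + a^m L] meet in [Q]. *)
  move=> [x nQx Qax].
  have [m|m y /= Qy|m stab] := @chain_stabilizes _ _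
    (fun m => [set x | Q (a ^+ m *: x)]) noethL.
  - exact: submodule_colon.
  - by rewrite exprS -scalerA; apply: submoduleZ.
  exists m => w.
  have [|z [/= Qaz [u Qu [v def_z]]]|/(_ x Qax)//|] :=
    irrQ _ _ (submodule_colon a sQ) (submodule_addZ (a ^+ m) sQ) (colonQ a).
  - by move=> u Qu; exists u => //; exists 0; rewrite scaler0 addr0.
  - move: Qaz; rewrite def_z scalerDr scalerA -exprS => Qau.
    apply: submoduleD => //; apply: (stab m.+1) => /=.
    rewrite -[X in Q X](addKr (a *: u)) addrC.
    by apply: submoduleB => //; apply: submoduleZ.
  - by apply; exists 0; [exact: submodule0|exists w; rewrite add0r].
have [s Ps] := noethR idP.
have sP a : a \in s -> P a by move=> sa; rewrite Ps; apply: sub_gen_smallest.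
(* [T m] is the colon [(Q : P^m)].  Were it to stabilize at a proper [T k],
   multiplying an element outside [T k] by suitable powers of the generators
   of [P] would give [y] outside [T k] with [P y] in [T k], that is, [y] in
   [T k.+1]. *)
pose T m := [set x | forall l : seq R, {subset l <= [in P]} ->
  (m <= size l)%N -> Q ((\prod_(a <- l) a) *: x)].
have sT m : submodule (T m).
  apply/submoduleP; split=> [l _ _|a x y Tx Ty l lP ml].
    by rewrite scaler0; apply: submodule0.
  rewrite scalerDr scalerA mulrC -scalerA.
  by apply: submoduleD; [|apply: submoduleZ; [|apply: Tx]|apply: Ty].
have [k stab] : exists k, forall p, T p `<=` T k.
  apply: chain_stabilizes => // m x Tx l lP ml.
  by apply: Tx; rewrite // ltnW.
exists k, P; split=> // [a x Qax|l lP kl x].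
  by have [Qx|nQx] := pselect (Q x); [right|left; exists x].
suff: T k x by apply.
apply: contrapT => {l lP kl} nTx.
have [y nTy sy] : exists2 y, ~ T k y & forall a, a \in s -> T k (a *: y).
  elim: s sP {Ps} => [|a s IHs] sP; first by exists x.
  have [b sb|y nTy sy] := IHs; first by apply: sP; rewrite inE sb orbT.
  have [m Qm] : exists m, T k (a ^+ m *: y).
    have [m Qm] := nilP a (sP a (mem_head _ _)).
    by exists m => l _ _; rewrite scalerA mulrC -scalerA; apply: Qm.
  (* The descent stops where [a ^+ m *: y] is outside [T k] but [a ^+ m.+1 *: y] is inside; the
     generators treated before still send this element into [T k]. *)
  elim: m Qm => [|m IHm Qm]; first by rewrite scale1r.
  have [/IHm//|nQm] := pselect (T k (a ^+ m *: y)).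
  exists (a ^+ m *: y) => // b; rewrite inE => /orP[/eqP->|sb].
    by rewrite scalerA -exprS.
  by rewrite scalerA mulrC -scalerA; apply: (submoduleZ _ (sT k)); apply: sy.
apply: nTy; apply: (stab k.+1) => -[|a l] // lP kl.
rewrite big_cons mulrC -scalerA.
have : P a by have := lP a (mem_head _ _); rewrite inE.
rewrite {1}Ps => Pa; have : T k (a *: y).
  move: a Pa {lP kl}; apply: smallest_sub => //.
  exact: (ideal_annihilator _ (sT k)).
by apply=> // b lb; apply: lP; rewrite inE lb orbT.
Qed.

(** A submodule that is not irreducible is the intersection of two strictly larger ones, whose
    families are joined with the larger of the two exponents. *)
Lemma power_primary_decomposition N : submodule N ->
  exists k (I : finType) (P : I -> set R) (Q : I -> set L),
    (forall i, power_primary k (P i) (Q i)) /\ N = \bigcap_(i in setT) Q i.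
Proof.
move: N; apply: noetherian_ind => // N sN IHN.
have [irrN|nirrN] := pselect (irreducible_submodule N).
  have [k [P ppN]] := irreducible_power_primary sN irrN.
  exists k, unit, (fun=> P), (fun=> N); split=> //.
  by apply/seteqP; split=> [x Nx _ _|x /(_ tt)]; [|apply].
have [N1 [N2 [[sN1 NN1 nN1] [sN2 NN2 nN2] N12]]] : exists N1 N2,
  [/\ [/\ submodule N1, N `<=` N1 & ~ N1 `<=` N],
      [/\ submodule N2, N `<=` N2 & ~ N2 `<=` N] & N1 `&` N2 `<=` N].
  apply: contrapT => noN; apply: nirrN => N1 N2 sN1 sN2 NN1 NN2 N12.
  have [|nN1] := pselect (N1 `<=` N); [by left|right].
  by apply: contrapT => nN2; apply: noN; exists N1, N2.
have [k1 [I1 [P1 [Q1 [ppQ1 defN1]]]]] := IHN N1 sN1 NN1 nN1.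
have [k2 [I2 [P2 [Q2 [ppQ2 defN2]]]]] := IHN N2 sN2 NN2 nN2.
exists (maxn k1 k2), (I1 + I2)%type.
exists (fun i => match i with inl i => P1 i | inr i => P2 i end).
exists (fun i => match i with inl i => Q1 i | inr i => Q2 i end).
split=> [[i|i]|].
- exact: power_primary_leq (leq_maxl _ _) (ppQ1 i).
- exact: power_primary_leq (leq_maxr _ _) (ppQ2 i).
apply/seteqP; split=> [x Nx [i|i] _|x Qx].
- by have := NN1 x Nx; rewrite defN1; apply.
- by have := NN2 x Nx; rewrite defN2; apply.
apply: N12; split.
  by rewrite defN1 => i _; apply: (Qx (inl i)).
by rewrite defN2 => i _; apply: (Qx (inr i)).
Qed.

End NoetherianPowerPrimary.

(** * Restriction to the graded components *)

Unset Implicit Arguments.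
Set Strict Implicit.

Theorem theorem2p4 (t : nat) (R : comPzRingType) (gR : ring_grading t R)
    (L : lmodType R) (gL : module_grading gR L) :
  (0 < t)%N ->
  noetherian R ->
  fg_submodule [set: L] ->
  exists k : nat, (0 < k)%N /\
    forall n : degree t, [set: component gL n] <> [set 0] ->
      exists (r : nat) (P : 'I_r -> set (degree0 gR))
             (Q : 'I_r -> set (component gL n)),
        primary_decomposition [set 0] P Q /\
        forall i, idealM (idealX (P i) k) [set: component gL n] `<=` Q i.
Proof.
move=> _ noethR fgL; have noethL := fg_noetherian_module noethR fgL.
have [|k [I [P [Q [ppQ def0]]]]] :=
    power_primary_decomposition noethR noethL (N := [set 0]).
  by apply/submoduleP; split=> // a x y -> ->; rewrite scaler0 addr0.
(* The exponent found over [R] may be zero, hence the successor; it is fixed before [n] is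
   introduced. *)
exists k.+1; split=> // n _.
pose P' (i : 'I_#|I|) : set (degree0 gR) := val @^-1` P (enum_val i).
pose Q' (i : 'I_#|I|) : set (component gL n) := val @^-1` Q (enum_val i).
have ppQ' i : power_primary k.+1 (P' i) (Q' i).
  apply: power_primary_preimage => //.
  exact: power_primary_leq (leqnSn k) (ppQ _).
(* Restricted pairs may be improper, redundant or share the same [P']; the reduction repairs this
   without changing the exponent. *)
have [|r [P1 [Q1 [dPQ ppQ1]]]] :=
    minimal_power_primary_decomposition ppQ' (N := [set 0]).
  apply/seteqP; split=> [_ -> i _|x Q'x].
    have : [set 0] (0 : L) by [].
    by rewrite def0; apply.
  apply: val_inj; have : (\bigcap_(i in setT) Q i) (val x).
    by move=> i _; have := Q'x (enum_rank i) Logic.I; rewrite /Q' /= enum_rankK.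
  by rewrite -def0.
exists r, P1, Q1; split=> // i; exact: power_primary_idealM.
Qed.
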